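(* Let $t\ge 1$, let $S$ be the group of plane rotations by multiples of $2\pi/t$, and let $\tilde A\in S$. Let $(i,j)$ be a pixel position, let $F_{ij}=(F^A_{ij})_{A\in S}$ with $F^A_{ij}\in\mathbb{R}^n$ be the feature at that pixel, and let $H_{ij}:\mathbb{R}^2\times S\to\mathbb{R}^m$ be a feature function (such as is output by an input layer or an intermediate layer). Let $\varphi$, $\psi$ be arbitrary functions and let $W_{in}$, $W$, $W_{out}$ be arbitrary parameters of an input layer, an intermediate layer and an output layer respectively. Then $$W_{in}\,\hat\circ_\varphi\big(\pi^F_{\tilde A}(F_{ij})\big)=\pi^H_{\tilde A}\big[W_{in}\,\hat\circ_\varphi F_{ij}\big],$$ $$W\,\tilde\circ\,\big(\pi^H_{\tilde A}[H_{ij}]\big)=\pi^H_{\tilde A}\big[W\,\tilde\circ\, H_{ij}\big],$$ $$W_{out}\,\check\circ_\psi\big(\pi^H_{\tilde A}[H_{ij}]\big)=\pi^f_{\tilde A}\big[W_{out}\,\check\circ_\psi H_{ij}\big].$$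
   Context: Group: $S=\{A_k : k=0,\dots,t-1\}$ with $A_k=\begin{bmatrix}\cos(2\pi k/t)&\sin(2\pi k/t)\\-\sin(2\pi k/t)&\cos(2\pi k/t)\end{bmatrix}$. Rotation operators, for $\tilde A\in S$: - on features at a pixel, $F_{ij}=(F^A_{ij})_{A\in S}$: $\pi^F_{\tilde A}(F_{ij})$ is the family whose $A$-component is $F_{ij}^{\tilde A^{-1}A}$; - on feature functions $H:\mathbb{R}^2\times S\to\mathbb{R}^m$: $\pi^H_{\tilde A}[H](x,A)=H(\tilde A^{-1}x,\tilde A^{-1}A)$; - on functions $f$ on $\mathbb{R}^2$: $\pi^f_{\tilde A}[f](x)=f(\tilde A^{-1}x)$. Layers: - Input layer: parameters $W_{in}=\{W_{in}^A\}_{A\in S}$ (each $W_{in}^A$ in some fixed parameter set) and an arbitrary function $\varphi$ (parameter, feature vector in $\mathbb{R}^n$, point of $\mathbb{R}^2$) $\mapsto$ vector; for $x\in\mathbb{R}^2$, $B\in S$, $[W_{in}\hat\circ_\varphi F_{ij}](x,B)=\sum_{A\in S}\varphi\big(W_{in}^{B^{-1}A},F^A_{ij},A^{-1}x\big)$. - Intermediate layer: parameters $W=\{W^A\}_{A\in S}$, matrices $W^A$ with $m$ columns; for $x\in\mathbb{R}^2$, $A\in S$, $[W\tilde\circ H](x,A)=\sum_{B\in S}W^{A^{-1}B}\,H(x,B)$. - Output layer: parameters $W_{out}=\{W^1_{out},W^2_{out}\}$, where $W^1_{out}$ is a matrix with as many columns as $H$ has channels, and $\psi_{W^2_{out}}$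 is an arbitrary function with parameters $W^2_{out}$; for $x\in\mathbb{R}^2$, $[W_{out}\check\circ_\psi H](x)=\psi_{W^2_{out}}\Big(\sum_{A\in S}W^1_{out}\,H(x,A)\Big)$. *)

(* Defs.v *)
From HB Require Import structures.
From mathcomp Require Import all_boot all_order all_algebra all_fingroup.
From mathcomp Require Import all_classical all_reals all_analysis.

Set Implicit Arguments.
Unset Strict Implicit.
Unset Printing Implicit Defensive.

Import Order.TTheory GRing.Theory Num.Theory.
Local Open Scope ring_scope.

Definition rotation_mx (R : realType) (t k : nat) : 'M[R]_2 :=
  let theta := 2 * pi * k%:R / t%:R in
  \matrix_(i < 2, j < 2)
    nth 0 (nth [::] [:: [:: cos theta; sin theta];
                        [:: - sin theta; cos theta]] i) j.

(* The set {A_0, ..., A_(t-1)}, as a finite subtype of the 2 x 2 matrices.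
   The positivity proof is a parameter because the set is empty, hence not a
   group, when t = 0. *)
Definition rotation_group (R : realType) (t : nat) (ht : (0 < t)%N) : Type :=
  seq_sub [seq rotation_mx R t k | k <- iota 0 t].

HB.instance Definition _ (R : realType) (t : nat) (ht : (0 < t)%N) :=
  Finite.copy (rotation_group R ht)
    (seq_sub [seq rotation_mx R t k | k <- iota 0 t]).

Section RotationGroup.
Variables (R : realType) (t : nat) (ht : (0 < t)%N).
Notation S := (rotation_group R ht).

Definition rot_mx (A : S) : 'M[R]_2 := val A.

Lemma rot_mx_inj : injective rot_mx.
Proof. exact: val_inj. Qed.

Lemma rotation_mx0 : rotation_mx R t 0 = 1%:M.
Proof.
apply/matrixP => i j; rewrite !mxE mulr0 mul0r cos0 sin0 oppr0.
by case: i j => [[|[|//]] ?] [[|[|//]] ?].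
Qed.

Lemma rotation_mxD k l :
  rotation_mx R t k *m rotation_mx R t l = rotation_mx R t (k + l).
Proof.
have E : 2 * pi * (k + l)%:R / t%:R
    = 2 * pi * k%:R / t%:R + 2 * pi * l%:R / t%:R :> R.
  by rewrite natrD mulrDr mulrDl.
apply/matrixP => i j; rewrite !mxE !big_ord_recl big_ord0 addr0 !mxE E.
rewrite cosD sinD.
case: i j => [[|[|//]] ?] [[|[|//]] ?] /=; rewrite ?mulrN ?mulNr ?opprD //.
- by rewrite addrC.
- by rewrite addrC.
Qed.

Lemma rotation_mx_modn k : rotation_mx R t (k %% t) = rotation_mx R t k.
Proof.
have E : 2 * pi * k%:R / t%:R
    = 2 * pi * (k %% t)%:R / t%:R + pi *+ 2 *+ (k %/ t) :> R.
  rewrite {1}(divn_eq k t) natrD natrM mulrDr mulrDl addrC; congr (_ + _).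
  rewrite mulrA mulfK ?pnatr_eq0 -?lt0n // mulr_natr.
  by rewrite mulr_natl.
apply/matrixP => i j; rewrite !mxE E.
by rewrite (periodicn (@cosD2pi R)) (periodicn (@sinD2pi R)).
Qed.

Lemma rotation_mx_mem k :
  rotation_mx R t k \in [seq rotation_mx R t k | k <- iota 0 t].
Proof.
rewrite -rotation_mx_modn; apply: map_f.
by rewrite mem_iota add0n leq0n ltn_mod.
Qed.

Lemma rot_mxP (A : S) : exists2 k, (k < t)%N & rot_mx A = rotation_mx R t k.
Proof.
by have /mapP[k] := ssvalP A; rewrite mem_iota add0n /= => kt E; exists k.
Qed.

Fact rot_mul_subproof (A B : S) :
  rot_mx A *m rot_mx B \in [seq rotation_mx R t k | k <- iota 0 t].
Proof.
have [k _ ->] := rot_mxP A; have [l _ ->] := rot_mxP B.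
by rewrite rotation_mxD rotation_mx_mem.
Qed.

Lemma rot_mx_inv (A : S) : exists2 k,
  rotation_mx R t k = invmx (rot_mx A) & rotation_mx R t k *m rot_mx A = 1%:M.
Proof.
have [k kt Ak] := rot_mxP A.
have E : rotation_mx R t (t - k) *m rot_mx A = 1%:M.
  by rewrite Ak rotation_mxD subnK 1?ltnW // -rotation_mx_modn modnn
             rotation_mx0.
have [_ AU] := mulmx1_unit E.
by exists (t - k)%N; rewrite // -[LHS]mulmx1 -(mulmxV AU) mulmxA E mul1mx.
Qed.

Fact rot_inv_subproof (A : S) :
  invmx (rot_mx A) \in [seq rotation_mx R t k | k <- iota 0 t].
Proof. by have [k <- _] := rot_mx_inv A; exact: rotation_mx_mem. Qed.

Fact rot_one_subproof :
  (1%:M : 'M[R]_2) \in [seq rotation_mx R t k | k <- iota 0 t].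
Proof. by rewrite -rotation_mx0 rotation_mx_mem. Qed.

Definition rot_mul (A B : S) : S := SeqSub (rot_mul_subproof A B).
Definition rot_inv (A : S) : S := SeqSub (rot_inv_subproof A).
Definition rot_one : S := SeqSub rot_one_subproof.

Fact rot_mulA : associative rot_mul.
Proof. by move=> A B C; apply: rot_mx_inj; exact: mulmxA. Qed.

Fact rot_mul1 : left_id rot_one rot_mul.
Proof. by move=> A; apply: rot_mx_inj; exact: mul1mx. Qed.

Fact rot_mulV : left_inverse rot_one rot_inv rot_mul.
Proof.
by move=> A; apply: rot_mx_inj; have [k E] := rot_mx_inv A; rewrite E.
Qed.

End RotationGroup.

HB.instance Definition _ (R : realType) (t : nat) (ht : (0 < t)%N) :=
  Finite_isGroup.Build (rotation_group R ht)
    (@rot_mulA R t ht) (@rot_mul1 R t ht) (@rot_mulV R t ht).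

Section Layers.
Variables (R : realType) (t : nat) (ht : (0 < t)%N).
Notation S := (rotation_group R ht).

(* Features and feature functions are those of one fixed pixel, since no
   operator below mixes pixels; functions on R^2 x S are curried. *)
Definition rotate (A : S) (x : 'cV[R]_2) : 'cV[R]_2 := rot_mx A *m x.

Definition rot_feature n (At : S) (F : S -> 'cV[R]_n) : S -> 'cV[R]_n :=
  fun A => F (At^-1 * A)%g.

Definition rot_feature_fun m (At : S) (H : 'cV[R]_2 -> S -> 'cV[R]_m) :
    'cV[R]_2 -> S -> 'cV[R]_m :=
  fun x A => H (rotate (At^-1)%g x) (At^-1 * A)%g.

Definition rot_fun (Y : Type) (At : S) (f : 'cV[R]_2 -> Y) : 'cV[R]_2 -> Y :=
  fun x => f (rotate (At^-1)%g x).

Definition input_layer (P : Type) n m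
    (phi : P -> 'cV[R]_n -> 'cV[R]_2 -> 'cV[R]_m) (Win : S -> P)
    (F : S -> 'cV[R]_n) : 'cV[R]_2 -> S -> 'cV[R]_m :=
  fun x B => \sum_(A : S) phi (Win (B^-1 * A)%g) (F A) (rotate (A^-1)%g x).

Definition intermediate_layer m p (W : S -> 'M[R]_(p, m))
    (H : 'cV[R]_2 -> S -> 'cV[R]_m) : 'cV[R]_2 -> S -> 'cV[R]_p :=
  fun x A => \sum_(B : S) W (A^-1 * B)%g *m H x B.

Definition output_layer (Q Y : Type) m q (psi : Q -> 'cV[R]_q -> Y)
    (W1 : 'M[R]_(q, m)) (W2 : Q) (H : 'cV[R]_2 -> S -> 'cV[R]_m) :
    'cV[R]_2 -> Y :=
  fun x => psi W2 (\sum_(A : S) W1 *m H x A).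

End Layers.

(* Main.v *)
Require Import Defs.
From mathcomp Require Import all_boot all_order all_algebra all_fingroup.
From mathcomp Require Import all_classical all_reals all_analysis.

(** Each layer sums over the whole group, and left translation by [At] permutes the group.
    Substituting [At * A] for the summation variable cancels the [At^-1] in the rotated input; the
    shift reappears in the relative index, since [B^-1 * (At * A) = (At^-1 * B)^-1 * A], which is
    what rotating the output does. *)

Lemma rotateM (R : realType) (t : nat) (ht : (0 < t)%N)
    (A B : rotation_group R ht) (x : 'cV[R]_2) :
  rotate (A * B)%g x = rotate A (rotate B x).
Proof. by rewrite /rotate mulmxA. Qed.

Theorem theorem1 (R : realType) (t : nat) (ht : (0 < t)%N)
    (At : rotation_group R ht) (n m l p q : nat) (P Q Y : Type)
    (Fij : rotation_group R ht -> 'cV[R]_n)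
    (Hij : 'cV[R]_2 -> rotation_group R ht -> 'cV[R]_m)
    (phi : P -> 'cV[R]_n -> 'cV[R]_2 -> 'cV[R]_l)
    (psi : Q -> 'cV[R]_q -> Y)
    (Win : rotation_group R ht -> P)
    (W : rotation_group R ht -> 'M[R]_(p, m))
    (Wout1 : 'M[R]_(q, m)) (Wout2 : Q) :
  [/\ input_layer phi Win (rot_feature At Fij)
        = rot_feature_fun At (input_layer phi Win Fij),
      intermediate_layer W (rot_feature_fun At Hij)
        = rot_feature_fun At (intermediate_layer W Hij)
    & output_layer psi Wout1 Wout2 (rot_feature_fun At Hij)
        = rot_fun At (output_layer psi Wout1 Wout2 Hij)].
Proof.
split; apply/funext => x; rewrite /rot_feature_fun /rot_fun.
- apply/funext => B; rewrite /input_layer (reindex_inj (mulgI At)).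
  apply: eq_bigr => A _.
  (* The point follows too: [(At * A)^-1] acts on [x] as [A^-1] acts on the rotated point [At^-1 x],
     by [rotateM]. *)
  by rewrite /rot_feature mulKg !invMg invgK rotateM mulgA.
- apply/funext => A; rewrite /intermediate_layer (reindex_inj (mulgI At)).
  by apply: eq_bigr => B _; rewrite mulKg invMg invgK mulgA.
(* [W1] does not depend on the group element, so the sum absorbs the shift entirely and only the
   rotation of [x] remains. *)
- rewrite /output_layer (reindex_inj (mulgI At)).
  by congr (psi _ _); apply: eq_bigr => A _; rewrite mulKg.
Qed.
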